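(* Let $\pi$ be a block-constructed permutation. Then $\pi$ is transposition Lagrangian, i.e. $\dim H^\pi_{V_2}=\dim V^\pi_2=g(\pi)$.
   Context: Two-row notation. Let $\mathcal{A}$ be an alphabet of $d$ letters. A pair of bijections $\pi_0,\pi_1:\mathcal{A}\to\{1,\dots,d\}$ is displayed as two rows, $\pi_0^{-1}(1),\dots,\pi_0^{-1}(d)$ on top and $\pi_1^{-1}(1),\dots,\pi_1^{-1}(d)$ on the bottom, and represents the permutation $\pi=\pi_1\circ\pi_0^{-1}$ of $\{1,\dots,d\}$; $\pi^{-1}$ corresponds to exchanging the rows. Blocks. A block is a pair of rows of equal length on the same sub-alphabet (each letter once in each row). The following blocks are used (written top row / bottom row); different blocks in a concatenation use disjoint alphabets. $\mathbf{S}$: $\alpha\,/\,\alpha$. $\mathbf{U}_{2n}$ ($n\ge1$): $\alpha_1\beta_1\alpha_2\beta_2\cdots\alpha_n\beta_n\,/\,\beta_1\alpha_1\beta_2\alpha_2\cdots\beta_n\alpha_n$. $\mathbf{V}_{2n}$ ($n>1$): $\alpha_1\beta_1\cdots\alpha_{n-2}\beta_{n-2}\,\alpha_{n-1}\beta_{n-1}\alpha_n\beta_n\,/\,\beta_1\alpha_1\cdots\beta_{n-2}\alpha_{n-2}\,\beta_n\alpha_n\beta_{n-1}\alpha_{n-1}$. $\mathbf{V}_{2,2}$: $\alpha_1\alpha_2\alpha_3\alpha_4\alpha_5\,/\,\alpha_5\alpha_4\alpha_3\alpha_2\alpha_1$. $\mathbf{W}_{2m+1,2n+1}$ ($m,n\ge0$):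 the concatenation of $\mathbf{U}_{2m}$, then $\varepsilon\zeta\eta\,/\,\eta\zeta\varepsilon$, then $\mathbf{U}_{2n}$ (with $\mathbf{U}_0$ empty). A permutation is block-constructed if it can be written with top row $A\,\mathbf{B}_1\cdots\mathbf{B}_k\,Z$ and bottom row $Z\,\mathbf{B}_1\cdots\mathbf{B}_k\,A$ (top, respectively bottom, rows of the blocks concatenated), where $A\neq Z$ are two further letters and each $\mathbf{B}_i$ is one of the blocks above. Such a permutation is irreducible and self-inverse. Spaces. $\Omega_\pi$ is the antisymmetric matrix indexed by $\mathcal{A}$ with $(\Omega_\pi)_{\alpha,\beta}=1$ if $\pi_0(\alpha)<\pi_0(\beta)$ and $\pi_1(\alpha)>\pi_1(\beta)$, $-1$ if $\pi_0(\alpha)>\pi_0(\beta)$ and $\pi_1(\alpha)<\pi_1(\beta)$, and $0$ otherwise. $g(\pi)$ is the genus of any suspension surface of $\pi$; it equals $\tfrac12\operatorname{rank}\Omega_\pi$. For self-inverse $\pi$, a transposition pair is a two-element orbit $\{\alpha,\beta\}$ of $\pi_0^{-1}\circ\pi_1$ on $\mathcal{A}$ (two letters exchanged between the rows). With $\mathbf{e}_\alpha$ the standard basis of $\mathbb{R}^{\mathcal{A}}$, $V^\pi_2$ is the span of the vectors $\mathbf{e}_\alpha+\mathbf{e}_\beta$ over all transposition pairs $\{\alpha,\beta\}$, and $H^\pi_{V_2}=\Omega_\pi V^\pi_2$. A self-inverse $\pi$ is transposition Lagrangian if $\dim H^\pi_{V_2}=\dim V^\pi_2=g(\pi)$. 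*)

(* Defs.v *)
From HB Require Import structures.
From mathcomp Require Import all_boot all_order all_algebra all_fingroup.
From mathcomp Require Import reals.

Set Implicit Arguments.
Unset Strict Implicit.
Unset Printing Implicit Defensive.

Import GRing.Theory.
Local Open Scope ring_scope.

(** Positions are counted from 0: ['I_d] stands for {1, ..., d}. *)

(** The pair of bijections [pi0], [pi1] represents [pi1 \o pi0^-1]. *)
Definition represents (A : finType) (d : nat) (pi0 pi1 : A -> 'I_d)
    (pi : 'S_d) : Prop :=
  [/\ bijective pi0, bijective pi1 & forall a, pi (pi0 a) = pi1 a].

(** [w] is the row p^-1(1), ..., p^-1(d).  When [p] is bijective this forces
    every letter to occur exactly once in [w]. *)
Definition is_row (A : finType) (d : nat) (p : A -> 'I_d) (w : seq A) : Prop :=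
  [seq p a | a <- w] = enum 'I_d.

(** The rows of U_{2n} on the letter pairs (alpha_1, beta_1), ...,
    (alpha_n, beta_n); both are empty for n = 0. *)
Definition U_top (A : Type) (ab : seq (A * A)) : seq A :=
  flatten [seq [:: p.1; p.2] | p <- ab].

Definition U_bot (A : Type) (ab : seq (A * A)) : seq A :=
  flatten [seq [:: p.2; p.1] | p <- ab].

(** [is_block t b]: [t] / [b] are the rows of a block.  Distinctness of the
    letters is not recorded here: it is enforced by [is_row] on the whole
    rows, both inside a block and between blocks. *)
Inductive is_block (A : Type) : seq A -> seq A -> Prop :=
| Block_S a : is_block [:: a] [:: a]
| Block_U ab : (0 < size ab)%N -> is_block (U_top ab) (U_bot ab)
| Block_V ab a b a' b' :
    is_block (U_top ab ++ [:: a; b; a'; b']) (U_bot ab ++ [:: b'; a'; b; a])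
| Block_V22 a1 a2 a3 a4 a5 :
    is_block [:: a1; a2; a3; a4; a5] [:: a5; a4; a3; a2; a1]
| Block_W ab e z h cd :
    is_block (U_top ab ++ [:: e; z; h] ++ U_top cd)
             (U_bot ab ++ [:: h; z; e] ++ U_bot cd).

Definition block_constructed (d : nat) (pi : 'S_d) : Prop :=
  exists (A : finType) (pi0 pi1 : A -> 'I_d),
    represents pi0 pi1 pi /\
    exists (a z : A) (bs : seq (seq A * seq A)),
      [/\ a != z,
          forall B, B \in bs -> is_block B.1 B.2,
          is_row pi0 (a :: flatten [seq B.1 | B <- bs] ++ [:: z])
        & is_row pi1 (z :: flatten [seq B.2 | B <- bs] ++ [:: a])].

(** Suspension surface: a polygon with 2d sides, whose upper and lower
    boundary chains both run from its leftmost to its rightmost vertex; the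
    [i]-th upper (lower) side is labelled by the [i]-th letter of the top
    (bottom) row, and the two sides with the same label are glued by a
    translation.  [inl i] ([inr i]) is the vertex at the end of the first [i]
    upper (lower) sides. *)
Definition glued_vertices (A : finType) (d : nat) (pi0 pi1 : A -> 'I_d)
    (i j : 'I_d.+1) : bool :=
  [|| (i == ord0) && (j == ord0),
      (i == ord_max) && (j == ord_max)
    | [exists a : A,
        ((i == pi0 a :> nat) && (j == pi1 a :> nat)) ||
        ((i == (pi0 a).+1 :> nat) && (j == (pi1 a).+1 :> nat))]].

Definition vertex_rel (A : finType) (d : nat) (pi0 pi1 : A -> 'I_d) :
    rel ('I_d.+1 + 'I_d.+1) :=
  fun x y => match x, y with
             | inl i, inr j | inr j, inl i => glued_vertices pi0 pi1 i j
             | _, _ => false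
             end.

Definition surface_vertices (A : finType) (d : nat) (pi0 pi1 : A -> 'I_d) :
    nat :=
  n_comp (vertex_rel pi0 pi1) predT.

(** The glued polygon has d edges and one face, so that
    2 - 2g = surface_vertices - d + 1. *)
Definition genus (A : finType) (d : nat) (pi0 pi1 : A -> 'I_d) : nat :=
  (d.+1 - surface_vertices pi0 pi1)./2.

Definition Omega_coef (R : pzRingType) (A : finType) (d : nat)
    (pi0 pi1 : A -> 'I_d) (a b : A) : R :=
  if (pi0 a < pi0 b)%N && (pi1 b < pi1 a)%N then 1
  else if (pi0 b < pi0 a)%N && (pi1 a < pi1 b)%N then -1
  else 0.

Definition Omega_fun (R : realType) (A : finType) (d : nat)
    (pi0 pi1 : A -> 'I_d) (v : {ffun A -> R^o}) : {ffun A -> R^o} :=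
  [ffun a => \sum_b Omega_coef R pi0 pi1 a b * v b].

Fact Omega_fun_is_linear (R : realType) (A : finType) (d : nat)
  (pi0 pi1 : A -> 'I_d) : linear (@Omega_fun R A d pi0 pi1).
Proof.
move=> k u v; apply/ffunP=> a; rewrite !ffunE scaler_sumr -big_split /=.
by apply: eq_bigr => b _; rewrite !ffunE mulrDr scalerAr.
Qed.

HB.instance Definition _ (R : realType) (A : finType) (d : nat)
    (pi0 pi1 : A -> 'I_d) :=
  GRing.isLinear.Build R {ffun A -> R^o} {ffun A -> R^o} *:%R
    (@Omega_fun R A d pi0 pi1) (@Omega_fun_is_linear R A d pi0 pi1).

Definition Omega (R : realType) (A : finType) (d : nat)
    (pi0 pi1 : A -> 'I_d) : 'End({ffun A -> R^o}) :=
  linfun (@Omega_fun R A d pi0 pi1).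

Definition basis_vec (R : realType) (A : finType) (a : A) : {ffun A -> R^o} :=
  [ffun b => (b == a)%:R].

(** {a, b} is a two-element orbit of pi0^-1 \o pi1. *)
Definition transposition_pair (A : finType) (d : nat) (pi0 pi1 : A -> 'I_d)
    (a b : A) : bool :=
  [&& a != b, pi1 a == pi0 b & pi1 b == pi0 a].

(** Each pair contributes its vector twice, as (a, b) and as (b, a), which
    does not affect the span. *)
Definition V2 (R : realType) (A : finType) (d : nat)
    (pi0 pi1 : A -> 'I_d) : {vspace {ffun A -> R^o}} :=
  span [seq basis_vec R p.1 + basis_vec R p.2
      | p <- enum {: A * A} & transposition_pair pi0 pi1 p.1 p.2].

Definition H_V2 (R : realType) (A : finType) (d : nat)
    (pi0 pi1 : A -> 'I_d) : {vspace {ffun A -> R^o}} :=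
  (Omega R pi0 pi1 @: V2 R pi0 pi1)%VS.

(** The dimensions and the genus are those of any labelling of [pi] (relabelling
    changes none of them); one exists, with letters ['I_d] and [pi0 = id]. *)
Definition transposition_lagrangian (R : realType) (d : nat) (pi : 'S_d) :
    Prop :=
  (pi^-1 = pi)%g /\
  forall (A : finType) (pi0 pi1 : A -> 'I_d), represents pi0 pi1 pi ->
    \dim (H_V2 R pi0 pi1) = \dim (V2 R pi0 pi1) /\
    \dim (V2 R pi0 pi1) = genus pi0 pi1.

(* Main.v *)
(** Every block is a concatenation of words that are reversed from the top row
    to the bottom row, so pi exchanges the two extreme positions and reverses
    consecutive segments of the middle, of lengths k_1, ..., k_m.  The genus and
    both dimensions then equal 1 + sum_i floor(k_i / 2).

    Dimensions: the vectors of the pairs are linearly independent.  If v lies in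
    their span and Omega v = 0, the difference of the rows of Omega at two
    consecutive letters a, b of a segment gives v_a + v_b = 0; as v is symmetric
    under the reversal and vanishes at a fixed letter, v is 0 on the middle, and
    the row of the first letter then kills the two extreme coordinates.

    Genus: along a segment the gluing links the i-th upper vertex to the
    (i+2)-nd, and likewise for lower vertices.  Starting from the identification
    of the upper and lower vertices at the left end of the middle, a segment of
    even length has all of its vertices identified, whereas one of odd length
    splits them into two classes according to parity.  Hence the number of
    vertices of the surface is 1 + #{i | k_i odd}. *)

Require Import Defs.
From mathcomp Require Import all_boot all_order all_algebra all_fingroup.
From mathcomp Require Import reals zify lra.

Set Implicit Arguments.
Unset Strict Implicit.
Unset Printing Implicit Defensive.

Import GRing.Theory.

(** * Reversed segments of block-constructed permutations *)

(** The segments are laid end to end from position [s]. Positions are in [nat], so that arithmetic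
    on them needs no bounds; [f] is unconstrained outside the segments. *)
Fixpoint reverses (f : nat -> nat) (s : nat) (ks : seq nat) : Prop :=
  if ks is k :: ks' then
    (forall i, i < k -> f (s + i) = s + (k - i.+1)) /\ reverses f (s + k) ks'
  else True.

(** A pair of [U] is a reversed two-letter word; the last four letters of [V], the three middle
    letters of [W] and all of [V22] are each one reversed word. *)
Lemma block_atoms (A : Type) (t b : seq A) : is_block t b ->
  exists ws, t = flatten ws /\ b = flatten (map rev ws).
Proof.
have UE ab : U_top ab = flatten [seq [:: p.1; p.2] | p <- ab] /\
    U_bot ab = flatten (map rev [seq [:: p.1; p.2] | p <- ab] : seq (seq A)).
  by rewrite /U_bot -map_comp.
case=> [a|ab _|ab a1 b1 a2 b2|a1 a2 a3 a4 a5|ab e z h cd].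
- by exists [:: [:: a]].
- by eexists; apply: UE.
- have [-> ->] := UE ab.
  exists ([seq [:: p.1; p.2] | p <- ab] ++ [:: [:: a1; b1; a2; b2]]).
  by rewrite map_cat !flatten_cat.
- by exists [:: [:: a1; a2; a3; a4; a5]].
- have [-> ->] := UE ab; have [-> ->] := UE cd.
  exists ([seq [:: p.1; p.2] | p <- ab] ++
          [:: e; z; h] :: [seq [:: p.1; p.2] | p <- cd]).
  by rewrite map_cat !flatten_cat.
Qed.

Lemma blocks_atoms (A : eqType) (bs : seq (seq A * seq A)) :
  (forall B, B \in bs -> is_block B.1 B.2) ->
  exists ws, flatten [seq B.1 | B <- bs] = flatten ws /\
             flatten [seq B.2 | B <- bs] = flatten (map rev ws).
Proof.
elim: bs => [|B bs IH] Hbs; first by exists [::].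
have [ws [/= -> ->]] := IH (fun C HC => Hbs C (@mem_behead _ (B :: bs) C HC)).
have [ws0 [-> ->]] := block_atoms (Hbs B (mem_head _ _)).
by exists (ws0 ++ ws); rewrite map_cat !flatten_cat.
Qed.

Lemma size_flatten_rev (A : Type) (ws : seq (seq A)) :
  size (flatten (map rev ws)) = size (flatten ws).
Proof. by elim: ws => //= w ws IH; rewrite !size_cat size_rev IH. Qed.

(** The hypothesis says that [f] follows each letter from the top row to the bottom row. A word and
    its reverse fill the same interval of positions, so the words can be treated one by one. *)
Lemma reverses_atoms (A : Type) (x0 : A) (f : nat -> nat) (s : nat)
    (ws : seq (seq A)) :
  (forall i j, i < size (flatten ws) -> j < size (flatten ws) ->
     nth x0 (flatten ws) i = nth x0 (flatten (map rev ws)) j ->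
     f (s + i) = s + j) ->
  reverses f s (shape ws).
Proof.
elim: ws s => //= w ws IH s Hf; split=> [i ltiw|].
  apply: Hf; rewrite ?size_cat; [lia | lia |].
  rewrite !nth_cat size_rev ltiw ltn_subrL (leq_ltn_trans _ ltiw) //=.
  by rewrite nth_rev; [congr nth; lia | lia].
apply: IH => i j lti ltj eqij; rewrite -!addnA; apply: Hf.
- by rewrite size_cat ltn_add2l.
- by rewrite size_cat ltn_add2l.
- by rewrite !nth_cat size_rev !ltnNge !leq_addr /= !addKn.
Qed.

Lemma row_nth (A : finType) d (p : A -> 'I_d) w x0 i :
  is_row p w -> i < d -> p (nth x0 w i) = i :> nat.
Proof.
move=> Hw ltid; have sw : size w = d.
  by rewrite -(size_map p) Hw size_enum_ord.
rewrite -(nth_map x0 (p x0)) ?sw // Hw.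
by rewrite nth_enum_ord.
Qed.

(** This discards the alphabet: the conclusion concerns [pi] alone and can be used with any
    labelling of it. *)
Lemma block_constructed_reverses d (pi : 'S_d) : block_constructed pi ->
  exists (f : nat -> nat) ks, [/\ d = (sumn ks).+2, forall p : 'I_d, pi p = f p :> nat,
    f 0 = (sumn ks).+1, f (sumn ks).+1 = 0 & reverses f 1 ks].
Proof.
case=> A [pi0 [pi1 [[bij0 bij1 piE] [a [z [bs [neaz Hbs]]]]]]].
have [ws [-> ->]] := blocks_atoms Hbs.
set w0 := a :: _; set w1 := z :: _ => row0 row1.
have s1 : size w1 = size w0.
  by rewrite /= !size_cat size_flatten_rev.
have dE : d = (sumn (shape ws)).+2.
  rewrite -(size_enum_ord d) -row0 size_map /= size_cat size_flatten /=; lia.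
have s0 : size w0 = d by rewrite -(size_map pi0) row0 size_enum_ord.
have sws : size (flatten ws) = sumn (shape ws) by rewrite size_flatten.
pose f n := index (nth a w0 n) w1.
have fE i j : i < d -> j < d -> nth a w0 i = nth a w1 j -> f i = j.
  move=> ltid ltjd eqij; rewrite /f eqij index_uniq ?s1 ?s0 //.
  by rewrite (@map_uniq _ _ pi1) // row1 enum_uniq.
have nth_last w : size w = sumn (shape ws) -> forall x y,
    nth a (x :: w ++ [:: y]) (sumn (shape ws)).+1 = y.
  by move=> sw x y; rewrite /= nth_cat sw ltnn subnn.
exists f, (shape ws); split=> //.
- move=> p; pose x := nth a w0 p.
  have pi0x : pi0 x = p by apply/val_inj; rewrite /= (row_nth a row0).
  rewrite -pi0x piE pi0x; apply/esym/fE => //.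
  apply: (bij_inj bij1); apply/val_inj.
  by rewrite /= (row_nth a row1).
- apply: fE; [lia | lia |].
  by rewrite /w1 nth_last // size_flatten_rev.
- by apply: fE; [lia | lia |]; rewrite /w0 nth_last.
- apply: (reverses_atoms (x0 := a)) => i j; rewrite sws => lti ltj eqij.
  apply: fE; rewrite ?dE; [lia | lia |].
  by rewrite /= !nth_cat size_flatten_rev sws lti ltj.
Qed.

Lemma reverses_segment f s ks p : reverses f s ks -> s <= p < s + sumn ks ->
  exists b k, [/\ s <= b, b + k <= s + sumn ks, b <= p < b + k &
    forall i, i < k -> f (b + i) = b + (k - i.+1)].
Proof.
elim: ks s => [|k ks IH] s /=; first by move=> _; lia.
case=> Hk Hks Hp; case: (ltnP p (s + k)) => Hpk.
  by exists s, k; split=> //; lia.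
have [|b [k' [? ? ? H]]] := IH _ Hks; first by lia.
by exists b, k'; split=> //; lia.
Qed.

(** Inside a segment of length [k], offset [i] goes to [k - i.+1], which is larger exactly when
    [i < k./2]. *)
Lemma count_excedances f s ks : reverses f s ks ->
  count (fun p => p < f p) (iota s (sumn ks)) = sumn [seq k./2 | k <- ks].
Proof.
elim: ks s => //= k ks IH s [Hk Hks].
rewrite iotaD count_cat IH //; congr (_ + _).
rewrite -{1}[s]addn0 iotaDl count_map.
rewrite (@eq_in_count _ _ (fun i => i < k./2)); last first.
  by move=> i; rewrite mem_iota => /andP[_ ltik] /=; rewrite Hk //; lia.
have lehk : k./2 <= k by lia.
rewrite -{2}(subnKC lehk) iotaD count_cat -[X in _ = X]addn0; congr (_ + _).
  rewrite -[RHS](size_iota 0); apply/eqP; rewrite -all_count; apply/allP=> i.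
  by rewrite mem_iota.
by apply/eqP; rewrite -leqn0 leqNgt -has_count; apply/hasPn=> i; rewrite mem_iota; lia.
Qed.

(** * Classes of the polygon vertices *)

(** Class of the [i]-th upper, as well as of the [i]-th lower, vertex of the
    middle: the number of odd segments to its left, plus 1 at odd offsets inside
    an odd segment.  The clauses agree where two segments meet. *)
Fixpoint vertex_class (ks : seq nat) (i : nat) : nat :=
  if ks is k :: ks' then
    if i <= k then nat_of_bool (odd k && odd i)
    else odd k + vertex_class ks' (i - k)
  else 0.

Lemma vertex_class0 ks : vertex_class ks 0 = 0.
Proof. by case: ks => //= k ks; rewrite andbF. Qed.

Lemma vertex_class_shift k ks i :
  vertex_class (k :: ks) (k + i) = odd k + vertex_class ks i.
Proof.
case: i => [|i] /=; first by rewrite addn0 leqnn vertex_class0 addn0 andbb.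
by rewrite ifN ?addKn //; lia.
Qed.

Lemma vertex_class_sumn ks : vertex_class ks (sumn ks) = count odd ks.
Proof.
elim: ks => // k ks IH.
by rewrite [sumn _]/= vertex_class_shift IH.
Qed.

Lemma vertex_class_le ks i : vertex_class ks i <= count odd ks.
Proof.
elim: ks i => //= k ks IH i; case: ifP => _; last by rewrite leq_add2l.
by case: (odd k) (odd i) => [] [].
Qed.

Lemma vertex_class_onto ks m : m <= count odd ks ->
  exists2 i, i <= sumn ks & vertex_class ks i = m.
Proof.
elim: ks m => [|k ks IH] m; first by rewrite leqn0 => /eqP ->; exists 0.
rewrite [count _ _]/= => Hm; case: (ltnP m (odd k)) => Hmk.
  by exists 0; rewrite ?vertex_class0 //; lia.
have [|i Hi Ei] := IH (m - odd k); first by lia.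
by exists (k + i); rewrite ?leq_add2l // vertex_class_shift Ei subnKC.
Qed.

(** Glued sides have ends of equal class: for odd [k], the offsets [i] and [k - i.+1] have the same
    parity, and for even [k] the parity does not count. *)
Lemma vertex_class_edge f s ks i : reverses f s ks -> i < sumn ks ->
  exists j, [/\ f (s + i) = s + j, j < sumn ks,
    vertex_class ks i = vertex_class ks j &
    vertex_class ks i.+1 = vertex_class ks j.+1].
Proof.
elim: ks s i => // k ks IH s i [Hk Hks]; rewrite [sumn _]/= => lti.
have [ltik|leki] := ltnP i k.
  exists (k - i.+1); rewrite Hk //=.
  have -> : i <= k by lia.
  have -> : k - i.+1 <= k by lia.
  have -> : k - i.+1 < k by lia.
  rewrite ltik /= oddB //=; split=> //; first by lia.
    by case: (odd k) (odd i) => [] [].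
  by case: (odd k) (odd i) => [] [].
have [|j [Ej ltj g0 g1]] := IH _ (i - k) Hks; first by lia.
have iE : i = k + (i - k) by lia.
exists (k + j); split; [by rewrite addnA -Ej; congr f; lia | by lia | |].
- by rewrite [in LHS]iE !vertex_class_shift g0.
- by rewrite [in LHS]iE -!addnS !vertex_class_shift g1.
Qed.

(** * Connectivity of the vertices along segments *)

Section Connectivity.

Variables (V : Type) (E : V -> V -> Prop).
Hypothesis E_refl : forall x, E x x.
Hypothesis E_sym : forall x y, E x y -> E y x.
Hypothesis E_trans : forall x y z, E x y -> E y z -> E x z.

(** [T i] and [B i] are the [i]-th upper and lower vertices of a segment. *)
Definition segment_edges k (T B : nat -> V) := forall i, i < k ->
  E (T i) (B (k - i.+1)) /\ E (T i.+1) (B (k - i.+1).+1).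

Lemma segment_edgesC k T B : segment_edges k T B -> segment_edges k B T.
Proof.
move=> H i ltik; have [|H1 H2] := H (k - i.+1); first by lia.
have E1 : k - (k - i.+1).+1 = i by lia.
by rewrite E1 in H1 H2; split; exact: E_sym.
Qed.

(** The left end of side [i] and the right end of side [i.+1] are both glued to [B (k - i.+1)],
    which links [T i] to [T i.+2]. *)
Lemma segment_parity k T B : segment_edges k T B ->
  forall i, i <= k -> E (T (odd i)) (T i).
Proof.
move=> H; elim/ltn_ind=> [[|[|i]]] IH lei //=.
rewrite negbK; apply: (E_trans (IH i _ _)); [lia | lia |].
have [|H1 _] := H i; first by lia.
have [|_ H2] := H i.+1; first by lia.
have E1 : (k - i.+2).+1 = k - i.+1 by lia.
by rewrite E1 in H2; apply/(E_trans H1)/E_sym.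
Qed.

(** By parity only offsets 0 and 1 matter. For odd [k], [T 1] meets [B 1] through [B k]; for even
    [k], [T 1] meets [B 0] through [B k], and [B 1] meets [T 0] through [T k]. *)
Lemma segment_connect k T B : segment_edges k T B -> E (T 0) (B 0) ->
  forall i, i <= k -> E (T i) (T (odd k && odd i)) /\
                      E (B i) (T (odd k && odd i)).
Proof.
move=> H E0; case: (posnP k) => [-> i|k_gt0].
  by rewrite leqn0 => /eqP ->; split=> //; apply: E_sym.
have HB := segment_edgesC H.
have PT := segment_parity H; have PB := segment_parity HB.
have [T0B T1B] := H 0 k_gt0; have [B0T B1T] := HB 0 k_gt0.
have Ek : (k - 1).+1 = k by rewrite subn1 prednK.
rewrite Ek in T1B B1T.
have PTk := PT k (leqnn k); have PBk := PB k (leqnn k).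
case: (boolP (odd k)) PTk PBk => /= [_|_] PTk PBk i lei.
  split; first exact/E_sym/PT.
  apply: (E_trans (E_sym (PB i lei))).
  case: (odd i) => /=; last exact: E_sym.
  exact: (E_trans PBk (E_sym T1B)).
split.
  apply: (E_trans (E_sym (PT i lei))); case: (odd i) => //=.
  exact/(E_trans T1B)/(E_trans (E_sym PBk))/E_sym.
apply: (E_trans (E_sym (PB i lei))); case: (odd i) => /=; last exact: E_sym.
exact/(E_trans B1T)/E_sym.
Qed.

Lemma segments_connect f s ks (T B : nat -> V) : reverses f s ks ->
  (forall p, s <= p < s + sumn ks ->
     E (T p) (B (f p)) /\ E (T p.+1) (B (f p).+1)) ->
  E (T s) (B s) ->
  exists r : nat -> V, forall i, i <= sumn ks ->
    E (T (s + i)) (r (vertex_class ks i)) /\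
    E (B (s + i)) (r (vertex_class ks i)).
Proof.
elim: ks s => [|k ks IH] s /=.
  move=> _ _ E0; exists (fun=> T s) => i; rewrite leqn0 => /eqP ->.
  by rewrite addn0; split=> //; apply: E_sym.
case=> Hk Hks Hf E0.
have Hseg : segment_edges k (fun i => T (s + i)) (fun i => B (s + i)).
  by move=> i ltik; rewrite !addnS -!Hk //; apply: Hf; lia.
have conn := segment_connect Hseg; rewrite /= addn0 in conn.
have {}conn := conn E0.
have [Tk Bk] := conn k (leqnn k).
have [||r Hr] := IH _ Hks.
- by move=> p Hp; apply: Hf; lia.
- exact/(E_trans Tk)/E_sym.
have [T0r _] := Hr 0 isT; rewrite addn0 vertex_class0 in T0r.
(* An odd first segment creates class 0, represented by [T s], and shifts the later classes by one;
   an even one creates none. *)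
exists (fun m => if m < odd k then T s else r (m - odd k)) => i lei.
case: (leqP i k) => [leik|ltki].
  have {conn}[Ti Bi] := conn i leik.
  suff Hs : E (T (s + (odd k && odd i)))
      (if (odd k && odd i : nat) < odd k then T s else r ((odd k && odd i) - odd k)).
    by split; [exact: (E_trans Ti) | exact: (E_trans Bi)].
  case: (odd k) (odd i) Tk => [] [] //=; rewrite ?addn0 => Tk //;
    exact/(E_trans (E_sym Tk)).
have [|Ti Bi] := Hr (i - k); first by lia.
rewrite -addnA subnKC in Ti Bi; last exact: ltnW.
by rewrite ltnNge leq_addr addKn.
Qed.

End Connectivity.

(** * Vertex count and genus *)

(** The map [c] is a complete invariant of the components, hence a bijection from their roots onto
    ['I_n]. *)
Lemma n_comp_classes (V : finType) (e : rel V) n (c : V -> 'I_n) :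
  symmetric e -> (forall x y, e x y -> c x = c y) ->
  (forall m, exists x, c x = m) -> (forall x y, c x = c y -> connect e x y) ->
  n_comp e predT = n.
Proof.
move=> e_sym c_e c_onto e_c; have csym := sym_connect_sym e_sym.
have c_conn x y : connect e x y -> c x = c y.
  case/connectP=> p; elim: p x => [|z p IH] x /=; first by move=> _ ->.
  by case/andP=> /c_e -> /IH H /H.
have -> : n_comp e predT = #|[pred x | roots e x]|.
  by apply: eq_card => x; rewrite !inE andbT.
rewrite -[RHS]card_ord -(card_in_image (f := c) (A := [pred x | roots e x])).
  apply: eq_card => m; rewrite inE.
  have [x <-] := c_onto m; apply/imageP; exists (fingraph.root e x).
    by rewrite inE roots_root.
  exact/c_conn/connect_root.
move=> x y; rewrite !inE => /eqP rx /eqP ry /e_c /(fingraph.rootP csym).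
by rewrite rx ry.
Qed.

Lemma genus_reverses (A : finType) n (pi0 pi1 : A -> 'I_n) (pi : 'S_n)
    (f : nat -> nat) (ks : seq nat) :
  represents pi0 pi1 pi -> n = (sumn ks).+2 ->
  (forall p : 'I_n, pi p = f p :> nat) ->
  f 0 = (sumn ks).+1 -> f (sumn ks).+1 = 0 -> reverses f 1 ks ->
  genus pi0 pi1 = (sumn [seq k./2 | k <- ks]).+1.
Proof.
move=> [bij0 bij1 piE] nE fE f0 fl Hrev.
have [L L0 L1] := bij0.
have pi1E a : pi1 a = f (pi0 a) :> nat by rewrite -piE fE.
set e := vertex_rel pi0 pi1.
have e_sym : symmetric e by case=> i [j|j].
pose T i : 'I_n.+1 + 'I_n.+1 := inl (inord i).
pose B i : 'I_n.+1 + 'I_n.+1 := inr (inord i).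
have edge p : p < n -> connect e (T p) (B (f p)) /\
                       connect e (T p.+1) (B (f p).+1).
  move=> ltpn; pose a := L (Ordinal ltpn).
  have pa : pi0 a = p :> nat by rewrite L1.
  have fa : f p = pi1 a by rewrite pi1E pa.
  have ltf : f p < n by rewrite fa.
  split; apply: connect1; rewrite /= /glued_vertices; apply/or3P/Or33/existsP;
    exists a; rewrite !inordK ?pa ?fa ?eqxx ?orbT //; lia.
have T0B0 : connect e (T 0) (B 0).
  apply: connect1; rewrite /= /glued_vertices; apply/or3P/Or31.
  by rewrite -!val_eqE /= !inordK.
have TnBn : connect e (T n) (B n).
  apply: connect1; rewrite /= /glued_vertices; apply/or3P/Or32.
  by rewrite -!val_eqE /= !inordK // eqxx.
pose q := count odd ks.
(* The middle starts at vertex 1, hence the predecessor. Gluing the two extreme letters joins vertex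
   0 to the right end of the middle, of class [q], and vertex [n] to its left end, of class 0. *)
pose c0 i := if i == 0 then q else if i == n then 0 else vertex_class ks i.-1.
have c0_le i : c0 i < q.+1.
  by rewrite ltnS /c0; do !case: ifP => // _; apply: vertex_class_le.
pose c (x : 'I_n.+1 + 'I_n.+1) : 'I_q.+1 :=
  match x with inl i | inr i => Ordinal (c0_le i) end.
have c0S i : i <= sumn ks -> c0 i.+1 = vertex_class ks i.
  by move=> lei; rewrite /c0 /= ifN //; lia.
have c0f p : p < n -> c0 p = c0 (f p) /\ c0 p.+1 = c0 (f p).+1.
  have c0n : c0 (sumn ks).+2 = 0 by rewrite /c0 nE eqxx.
  case: p => [|p] ltpn.
    by rewrite f0 c0n c0S // vertex_class_sumn c0S // vertex_class0.
  move: ltpn; rewrite nE !ltnS leq_eqVlt => /orP[/eqP ->|ltps].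
    by rewrite fl c0n !c0S // vertex_class_sumn vertex_class0.
  have [j [-> ltj gj gj1]] := vertex_class_edge Hrev ltps.
  by rewrite !add1n !c0S // ltnW.
have surf : surface_vertices pi0 pi1 = q.+1.
  apply: (n_comp_classes (c := c)) => //.
  - have glue i j : glued_vertices pi0 pi1 i j -> c0 i = c0 j.
      case/or3P=> [/andP[/eqP -> /eqP ->]|/andP[/eqP -> /eqP ->]|] //.
      by case/existsP=> a /orP[] /andP[/eqP -> /eqP ->];
        rewrite pi1E; have [] := c0f _ (ltn_ord (pi0 a)).
    case=> i [] j //= H; apply/val_inj => /=; first exact: glue.
    exact/esym/glue.
  - move=> m; have [|i lei Ei] := @vertex_class_onto ks m; first by rewrite -ltnS.
    exists (T i.+1); apply/val_inj; rewrite /= inordK ?c0S //; lia.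
  - have sym x y : connect e x y -> connect e y x.
      by rewrite (sym_connect_sym e_sym).
    have tr := @connect_trans _ e.
    have n_gt0 : 0 < n by rewrite nE.
    have [T0Bl T1Bn] := edge 0 n_gt0; rewrite f0 -nE in T0Bl T1Bn.
    have ltln : (sumn ks).+1 < n by rewrite nE.
    have [TlB0 TnB1] := edge _ ltln; rewrite fl -nE in TlB0 TnB1.
    (* The path [T 1], [B n], [T n], [B 1] starts the induction along the segments. *)
    have T1B1 : connect e (T 1) (B 1).
      exact/(tr _ _ _ T1Bn)/(tr _ _ _ (sym _ _ TnBn)).
    have [|r Hr] := segments_connect (@connect0 _ e) sym (fun x y z => @tr y x z)
      Hrev _ T1B1.
      by move=> p Hp; apply: edge; lia.
    have Hall i : i <= n ->
        connect e (T i) (r (c0 i)) /\ connect e (B i) (r (c0 i)).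
      case: i => [_|i].
        have [//|] := Hr (sumn ks).
        rewrite add1n vertex_class_sumn => TT BB; rewrite /c0 /=; split.
          exact: (tr _ _ _ T0Bl).
        exact: (tr _ _ _ (sym _ _ TlB0)).
      move=> ltin; have [lei|lti] := leqP i (sumn ks).
        by rewrite c0S //; apply: Hr.
      have -> : i.+1 = n by lia.
      have -> : c0 n = 0 by rewrite /c0 eqxx; case: eqP => // n0; rewrite n0 in nE.
      have [//|] := Hr 0; rewrite vertex_class0 => TT BB; split.
        exact: (tr _ _ _ TnB1).
      exact: (tr _ _ _ (sym _ _ T1Bn)).
    have Hx x : connect e x (r (c x)).
      case: x => i; (have [|] := Hall i; first by rewrite -ltnS) => HT HB.
        by rewrite /T inord_val in HT.
      by rewrite /B inord_val in HB.
    move=> x y cxy; apply: (connect_trans (Hx x)).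
    by rewrite cxy (sym_connect_sym e_sym).
have sE : sumn ks = q + (sumn [seq k./2 | k <- ks]).*2.
  rewrite /q; elim: (ks) => //= k ks' ->.
  by rewrite -{1}(odd_double_half k); lia.
by rewrite /genus surf nE sE; lia.
Qed.

Local Open Scope ring_scope.

(** * Transposition pairs, [V2] and the kernel of [Omega] *)

Lemma reverses_involutive n (pi : 'S_n) (f : nat -> nat) (ks : seq nat) :
  n = (sumn ks).+2 -> (forall p : 'I_n, pi p = f p :> nat) ->
  f 0%N = (sumn ks).+1 -> f (sumn ks).+1 = 0%N -> reverses f 1 ks ->
  forall p, pi (pi p) = p.
Proof.
move=> nE fE f0 fl Hrev p; apply/val_inj; rewrite /= !fE.
have := ltn_ord p; case: (nat_of_ord p) => [|q]; first by rewrite f0 fl.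
rewrite nE !ltnS leq_eqVlt => /orP[/eqP ->|ltq]; first by rewrite fl f0.
have [|b [k [leb lebk Hb Hf]]] := reverses_segment (p := q.+1) Hrev; first by lia.
have -> : q.+1 = (b + (q.+1 - b))%N by lia.
by rewrite !Hf; lia.
Qed.

Section Transpositions.

Variables (R : realType) (A : finType) (n : nat) (pi0 pi1 : A -> 'I_n).
Variable tau : A -> A.
Hypotheses (pi0_inj : injective pi0) (pi0_tau : forall a, pi0 (tau a) = pi1 a)
  (tauK : involutive tau).

Let ffn := {ffun A -> R^o}.

Lemma transposition_pairE a b :
  transposition_pair pi0 pi1 a b = (a != b) && (b == tau a).
Proof.
rewrite /transposition_pair -!pi0_tau !(inj_eq pi0_inj) [tau a == b]eq_sym.
by case: (b =P tau a) => [->|]; rewrite ?tauK ?eqxx ?andbT.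
Qed.

(** Each transposition pair has exactly one such letter, so this set indexes the pairs without
    repetition. *)
Definition excedances : {set A} := [set a | (pi0 a < pi1 a)%N].

Lemma excedance_tau a : a \in excedances -> tau a \notin excedances.
Proof. by rewrite !inE -!pi0_tau tauK -leqNgt => /ltnW. Qed.

Let X : #|excedances|.-tuple ffn :=
  [tuple basis_vec R (enum_val i) + basis_vec R (tau (enum_val i))
   | i < #|excedances|].

Lemma span_excedances : V2 R pi0 pi1 = <<X>>%VS.
Proof.
apply/eqP; rewrite eqEsubv; apply/andP; split; apply/span_subvP=> v.
  case/mapP=> [[a b]]; rewrite mem_filter transposition_pairE /=.
  case/andP=> /andP[ab /eqP bE] _ ->; rewrite bE in ab *.
  have exc c : c \in excedances ->
      basis_vec R c + basis_vec R (tau c) \in <<X>>%VS.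
    move=> cE; apply: memv_span; apply/mapP.
    by exists (enum_rank_in cE c); rewrite ?mem_enum // enum_rankK_in.
  have [ltab|ltba|eqab] := ltngtP (pi0 a) (pi1 a).
  - by apply: exc; rewrite inE.
  - by rewrite addrC -{2}[a]tauK; apply: exc; rewrite inE -!pi0_tau tauK pi0_tau.
  - move: eqab; rewrite -pi0_tau => /val_inj/pi0_inj eqab.
    by rewrite -eqab eqxx in ab.
case/mapP=> i _ ->; set a := enum_val i.
have aE : a \in excedances by apply: enum_valP.
apply: memv_span; apply/mapP; exists (a, tau a) => //.
rewrite mem_filter transposition_pairE eqxx andbT mem_enum inE andbT /=.
by apply: contraTneq aE => aE; rewrite inE -pi0_tau -aE ltnn.
Qed.

(** Evaluating a vanishing combination at an excedance isolates its coefficient, since [tau] sends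
    excedances to non-excedances. *)
Lemma dim_V2 : \dim (V2 R pi0 pi1) = #|excedances|.
Proof.
rewrite span_excedances; apply/eqP; rewrite -[eqbRHS](size_tuple X) -/(free X).
apply/freeP=> k Hk i; move/ffunP: Hk => /(_ (enum_val i)).
rewrite !ffunE sum_ffunE (bigD1 i) //= big1 ?addr0 => [|j ji].
  rewrite (nth_map i) ?size_enum_ord // nth_ord_enum !ffunE eqxx.
  have /negPf -> : enum_val i != tau (enum_val i).
    by apply: contraTneq (enum_valP i) => E; rewrite E excedance_tau ?enum_valP.
  by rewrite addr0 => /eqP; rewrite mulf_eq0 oner_eq0 orbF => /eqP.
rewrite ffunE (nth_map i) ?size_enum_ord // nth_ord_enum !ffunE.
rewrite (inj_eq enum_val_inj) eq_sym (negPf ji) add0r.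
have /negPf -> : enum_val i != tau (enum_val j).
  by apply: contraTneq (enum_valP i) => ->; rewrite excedance_tau ?enum_valP.
by rewrite scaler0.
Qed.

Lemma V2_symmetric v : v \in V2 R pi0 pi1 ->
  (forall a, v (tau a) = v a) /\ (forall a, tau a = a -> v a = 0).
Proof.
rewrite span_excedances => /coord_span ->.
split=> [a|a aE]; rewrite !sum_ffunE.
  apply: eq_bigr => i _; rewrite !ffunE (nth_map i) ?size_enum_ord //.
  rewrite nth_ord_enum !ffunE (inv_eq tauK) (can_eq tauK); congr (_ *: _).
  by rewrite addrC.
apply: big1 => i _; rewrite !ffunE (nth_map i) ?size_enum_ord //.
rewrite nth_ord_enum !ffunE.
have iE : tau (enum_val i) != enum_val i.
  by apply: contraTneq (enum_valP i) => E; rewrite -E excedance_tau ?enum_valP.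
have -> : (a == enum_val i) = false.
  by apply: contraNF iE => /eqP <-; rewrite aE.
rewrite -aE (can_eq tauK) (_ : _ == _ = false) ?addr0 ?scaler0 //.
by apply: contraNF iE => /eqP <-; rewrite aE.
Qed.

Lemma Omega_consecutive a b v : Omega R pi0 pi1 v = 0 ->
  pi0 b = (pi0 a).+1 :> nat -> pi1 a = (pi1 b).+1 :> nat -> v a + v b = 0.
Proof.
rewrite lfunE => /ffunP Hv ab0 ab1.
have := Hv a; have := Hv b; rewrite !ffunE => Hb Ha.
have neba : b != a by apply: contra_eqN ab0 => /eqP ->; lia.
have pi1_inj c e : pi1 c = pi1 e -> c = e.
  by rewrite -!pi0_tau => /pi0_inj/(can_inj tauK).
(* In the difference of the two rows, columns [a] and [b] have coefficient 1; any other letter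
   compares alike with both in each row and cancels. *)
have := congr2 (fun x y => x - y) Ha Hb.
rewrite subrr -sumrB (bigD1 a) //= (bigD1 b) //= big1 => [|c /andP[ca cb]].
  rewrite /Omega_coef ab0 ab1 !ltnn !leqnn /= !ltnNge !leqnSn /=; lra.
have c0a : pi0 c != pi0 a :> nat by apply: contra ca => /eqP/val_inj/pi0_inj ->.
have c0b : pi0 c != pi0 b :> nat by apply: contra cb => /eqP/val_inj/pi0_inj ->.
have c1a : pi1 c != pi1 a :> nat by apply: contra ca => /eqP/val_inj/pi1_inj ->.
have c1b : pi1 c != pi1 b :> nat by apply: contra cb => /eqP/val_inj/pi1_inj ->.
rewrite /Omega_coef.
have -> : (pi0 b < pi0 c)%N = (pi0 a < pi0 c)%N by lia.
have -> : (pi0 c < pi0 b)%N = (pi0 c < pi0 a)%N by lia.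
have -> : (pi1 b < pi1 c)%N = (pi1 a < pi1 c)%N by lia.
have -> : (pi1 c < pi1 b)%N = (pi1 c < pi1 a)%N by lia.
exact: subrr.
Qed.

End Transpositions.

(** The extra 1 comes from position 0; the last position is not an excedance. *)
Lemma card_excedances (A : finType) n (pi0 pi1 : A -> 'I_n)
    (f : nat -> nat) (ks : seq nat) :
  bijective pi0 -> (forall a, pi1 a = f (pi0 a) :> nat) ->
  n = (sumn ks).+2 -> f 0%N = (sumn ks).+1 -> f (sumn ks).+1 = 0%N ->
  reverses f 1 ks ->
  #|excedances pi0 pi1| = (sumn [seq k./2 | k <- ks]).+1.
Proof.
move=> bij0 pi1E nE f0 fl Hrev.
have -> : excedances pi0 pi1 = pi0 @^-1: [set p : 'I_n | (p < f p)%N].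
  by apply/setP=> a; rewrite !inE pi1E.
rewrite on_card_preimset; last exact: onW_bij.
rewrite cardsE cardE size_filter -(count_map val (fun p => (p < f p)%N)).
rewrite -enumT val_enum_ord nE -addn1 iotaD /= count_cat /= f0 fl.
by rewrite (count_excedances Hrev) !addn0 add1n.
Qed.

Lemma V2_Omega_injective (R : realType) (A : finType) n (pi0 pi1 : A -> 'I_n)
    (tau : A -> A) (f : nat -> nat) (ks : seq nat) (v : {ffun A -> R^o}) :
  bijective pi0 -> (forall a, pi1 a = f (pi0 a) :> nat) ->
  n = (sumn ks).+2 -> f 0%N = (sumn ks).+1 -> f (sumn ks).+1 = 0%N ->
  reverses f 1 ks -> (forall a, pi0 (tau a) = pi1 a) -> involutive tau ->
  v \in V2 R pi0 pi1 -> Omega R pi0 pi1 v = 0 -> v = 0.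
Proof.
move=> bij0 pi1E nE f0 fl Hrev pi0_tau tauK vV2 Ov; subst n.
have [L L0 L1] := bij0; have pi0_inj := can_inj L0.
have [vtau vfix] := V2_symmetric pi0_inj pi0_tau tauK vV2.
pose x p := L (inord p).
have x0 p : (p < (sumn ks).+2)%N -> pi0 (x p) = p :> nat.
  by move=> ltp; rewrite L1 inordK.
have x1 p : (p < (sumn ks).+2)%N -> pi1 (x p) = f p :> nat.
  by move=> ltp; rewrite pi1E x0.
have xE a : a = x (pi0 a) by rewrite /x inord_val L0.
have tau_x p : (p < (sumn ks).+2)%N -> tau (x p) = x (f p).
  by move=> ltp; rewrite [LHS]xE pi0_tau x1.
have vmid p : (1 <= p < (sumn ks).+1)%N -> v (x p) = 0.
  move=> Hp; have [b [k [leb lebk Hb Hf]]] := reverses_segment Hrev Hp.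
  (* Consecutive coordinates cancel, so signs alternate along the segment. *)
  have valt i : (i < k)%N -> v (x (b + i)%N) = (-1) ^+ i * v (x b).
    elim: i => [|i IH] ltik; first by rewrite addn0 expr0 mul1r.
    have /eqP : v (x (b + i)%N) + v (x (b + i.+1)%N) = 0.
      by apply: (Omega_consecutive pi0_inj pi0_tau tauK Ov);
        rewrite ?x0 ?x1 ?Hf; lia.
    rewrite IH; last lia.
    by rewrite addrC addr_eq0 exprS mulN1r mulNr => /eqP.
  have vsym i : (i < k)%N -> v (x (b + (k - i.+1))%N) = v (x (b + i)%N).
    by move=> ltik; rewrite -Hf // -tau_x ?vtau //; lia.
  have vb : v (x b) = 0.
    (* For odd [k] the middle letter is fixed, so its coordinate is 0; for even [k] the two end
       coordinates are both equal and opposite. *)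
    have [oddk|evenk] := boolP (odd k).
      have ltk2 : (k./2 < k)%N by lia.
      have := vfix (x (b + k./2)%N).
      rewrite tau_x ?Hf; [|lia..].
      have -> : (k - k./2.+1 = k./2)%N by move: (odd_double_half k); lia.
      move=> /(_ erefl); rewrite valt // => /eqP.
      by rewrite mulf_eq0 signr_eq0 => /eqP.
    have k_gt0 : (0 < k)%N by lia.
    have := vsym 0%N k_gt0; rewrite !valt; [|lia..].
    by rewrite expr0 mul1r -signr_odd oddB // (negPf evenk) /= expr1; lra.
  have -> : p = (b + (p - b))%N by lia.
  by rewrite valt ?vb ?mulr0 //; lia.
(* With the middle coordinates zero, the row of the first letter reduces to the last coordinate;
   symmetry under [tau] then gives the first. *)
have vl : v (x (sumn ks).+1) = 0.
  move: Ov; rewrite lfunE => /ffunP/(_ (x 0%N)); rewrite !ffunE.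
  rewrite (bigD1 (x (sumn ks).+1)) //= big1 => [|a neal].
    by rewrite /Omega_coef !x0 // !x1 // f0 fl /= mul1r addr0.
  have [a0|a_gt0] := posnP (pi0 a).
    by rewrite (xE a) a0 /Omega_coef !ltnn mul0r.
  rewrite [v a](_ : _ = 0) ?mulr0 // (xE a) vmid // a_gt0 ltn_neqAle -ltnS ltn_ord andbT.
  by apply: contra neal => /eqP E; rewrite [a]xE E.
apply/ffunP=> a; rewrite !ffunE (xE a).
have [->|a_gt0] := posnP (pi0 a); first by rewrite -vtau tau_x // f0.
have [lta|gea] := ltnP (pi0 a) (sumn ks).+1; first by rewrite vmid // a_gt0.
suff -> : (pi0 a : nat) = (sumn ks).+1 by [].
by apply/eqP; rewrite eqn_leq gea -ltnS ltn_ord.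
Qed.

Theorem theorem4p22 (R : realType) (d : nat) (pi : 'S_d)
    (hpi : block_constructed pi) : transposition_lagrangian R pi.
Proof.
have [f [ks [dE fE f0 fl Hrev]]] := block_constructed_reverses hpi.
have piK := reverses_involutive dE fE f0 fl Hrev.
(* The labelling is arbitrary, not that of the block construction; [f] and [ks] carry over because
   they describe [pi]. *)
split=> [|A pi0 pi1 rep].
  by apply/permP=> p; apply: (@perm_inj _ pi); rewrite permKV piK.
have [bij0 _ piE] := rep; have [L L0 L1] := bij0.
have pi0_inj := can_inj L0.
pose tau a := L (pi1 a).
have pi0_tau a : pi0 (tau a) = pi1 a by rewrite L1.
have tauK : involutive tau.
  by move=> a; apply: pi0_inj; rewrite pi0_tau -piE pi0_tau -piE piK.
have pi1E a : pi1 a = f (pi0 a) :> nat by rewrite -piE fE.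
split.
  apply: limg_dim_eq; apply/eqP; rewrite -subv0; apply/subvP=> v.
  rewrite memv_cap memv_ker memv0 => /andP[vV2 /eqP Ov].
  by apply/eqP; apply: (V2_Omega_injective bij0 pi1E dE f0 fl Hrev pi0_tau tauK).
rewrite (dim_V2 _ pi0_inj pi0_tau tauK).
rewrite (card_excedances bij0 pi1E dE f0 fl Hrev).
by rewrite (genus_reverses rep dE fE f0 fl Hrev).
Qed.
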